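(* Let $a>0$ be any real number. Then: (i) there is no rotationally symmetric harmonic diffeomorphism from $\mathbb{D}^*$ onto $P(a)$, where $P(a)$ is equipped with its Euclidean metric; (ii) on the other hand, there exist rotationally symmetric harmonic diffeomorphisms from $P(a)$ onto $\mathbb{D}^*$, where $\mathbb{D}^*$ is equipped with its Euclidean metric.
   Context: Let $\mathbb{D}=\{z\in\mathbb{C}:|z|<1\}$, $\mathbb{D}^*=\mathbb{D}\setminus\{0\}$, and, for $a>0$, $P(a)=\mathbb{D}\setminus\{|z|\le e^{-a}\}=\{z\in\mathbb{C}: e^{-a}<|z|<1\}$. Harmonic map: let $M$ and $N$ be oriented surfaces with metrics $\tau^2|dz|^2$ and $\sigma^2|du|^2$ respectively, where $z$ and $u$ are local complex coordinates on $M$ and $N$. A $C^2$ map $u$ from $M$ to $N$ is harmonic if and only if $$u_{z\bar z}+\frac{2\sigma_u}{\sigma}\,u_z u_{\bar z}=0,$$ where $\sigma_u$ denotes the Wirtinger derivative $\partial\sigma/\partial u$ evaluated along the map. Here the target has the Euclidean metric $|du|$, i.e. $\sigma\equiv 1$, so that harmonicity means $u_{z\bar z}=0$, where $z$ is the standard complex coordinate on the domain (the condition does not depend on the choice of conformal metric on the domain). Rotationally symmetric: with $(r,\theta)$ the polar coordinates on the domain ($z=re^{i\theta}$), a map is rotationally symmetric if it has the form $z=re^{i\theta}\mapsto h(r)e^{i\theta}$ for some positive real-valued function $h$ of $r$. *)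

(* Defs.v *)
From Stdlib Require Export Reals.
From Coquelicot Require Export Coquelicot.
Open Scope R_scope.

Definition punctured_disk (z : C) : Prop := Cmod z < 1 /\ z <> RtoC 0.

Definition annulus (a : R) (z : C) : Prop := Cmod z < 1 /\ ~ Cmod z <= exp (- a).

(* Maps between plane domains are total functions C -> C, constrained only on
   their domain.  All domains U below are open, so values outside U influence
   neither continuity nor derivatives at points of U. *)

Definition maps_to (U V : C -> Prop) (u : C -> C) : Prop :=
  forall z, U z -> V (u z).

(* [ex_diff_n f n x y] only concerns the partial derivatives at (x, y) itself;
   required at every point of an open U it says that f is C^n on U. *)
Definition Cn_on (U : C -> Prop) (n : nat) (u : C -> C) : Prop :=
  forall z, U z ->
    ex_diff_n (fun x y => Re (u (x, y))) n (Re z) (Im z) /\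
    ex_diff_n (fun x y => Im (u (x, y))) n (Re z) (Im z).

Definition smooth_on (U : C -> Prop) (u : C -> C) : Prop :=
  forall n, Cn_on U n u.

Definition diffeomorphism (U V : C -> Prop) (u : C -> C) : Prop :=
  maps_to U V u /\ smooth_on U u /\
  exists v : C -> C,
    maps_to V U v /\ smooth_on V v /\
    (forall z, U z -> v (u z) = z) /\
    (forall w, V w -> u (v w) = w).

Definition partial_x (u : C -> C) (z : C) : C :=
  (Derive (fun x => Re (u (x, Im z))) (Re z),
   Derive (fun x => Im (u (x, Im z))) (Re z)).

Definition partial_y (u : C -> C) (z : C) : C :=
  (Derive (fun y => Re (u (Re z, y))) (Im z),
   Derive (fun y => Im (u (Re z, y))) (Im z)).

Definition d_z (u : C -> C) (z : C) : C :=
  Cdiv (Cminus (partial_x u z) (Cmult Ci (partial_y u z))) (RtoC 2).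

Definition d_zbar (u : C -> C) (z : C) : C :=
  Cdiv (Cplus (partial_x u z) (Cmult Ci (partial_y u z))) (RtoC 2).

(* [sigma] is the density of the conformal metric sigma(w)^2 |dw|^2 on the
   target V.  The equation does not involve the metric of the domain U. *)
Definition harmonic_map (U V : C -> Prop) (sigma : C -> R) (u : C -> C) : Prop :=
  maps_to U V u /\ Cn_on U 2 u /\
  forall z, U z ->
    Cplus (d_zbar (d_z u) z)
      (Cmult
         (Cdiv (Cmult (RtoC 2) (d_z (fun w => RtoC (sigma w)) (u z)))
               (RtoC (sigma (u z))))
         (Cmult (d_z u z) (d_zbar u z)))
    = RtoC 0.

Definition euclidean (w : C) : R := 1.

Definition polar (r theta : R) : C := Cmult (RtoC r) (cos theta, sin theta).

Definition rot_symmetric (U : C -> Prop) (u : C -> C) : Prop :=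
  exists h : R -> R,
    forall r theta, 0 < r -> U (polar r theta) ->
      0 < h r /\ u (polar r theta) = polar (h r) theta.

Definition rot_symmetric_harmonic_diffeo
    (U V : C -> Prop) (sigma : C -> R) (u : C -> C) : Prop :=
  rot_symmetric U u /\ harmonic_map U V sigma u /\ diffeomorphism U V u.

(* Main.v *)
From Stdlib Require Import Lra.
Require Import Defs.

(** A rotationally symmetric map is multiplication by a radial factor,
    [u z = phi |z| * z] with [phi r = h r / r].  For such a map the first
    Wirtinger derivative is again radial and, moreover, real:
    [d_z u = phi + r phi' / 2 = (h' + h / r) / 2] at [r = |z|]
    ([d_z_radial]).  Since the target is flat, harmonicity says that the
    other Wirtinger derivative kills this real radial function, i.e. that
    its derivative in [r] vanishes ([d_zbar_of_modulus]).  So [u] is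
    harmonic exactly when [h' + h / r] is constant; this first integral
    avoids both the second-order equation for [h] and the symmetry of mixed
    partial derivatives.  Multiplied by [r] it reads [(r h)' = 2 c r], hence
    [r h = c r^2 + b] ([rot_symmetric_harmonic_profile]).

    A map from the punctured disk into the annulus [q < |w| < 1] has
    [q < h < 1] on all of [(0, 1)].  As [r] tends to 0 the upper bound forces
    [b = 0], so [h = c r], which tends to 0 and violates the lower bound.

    In the other direction, take [c] and [b] so that [h q = 0] and [h 1 = 1]:
    [h r = (r - q^2 / r) / (1 - q^2)] increases from 0 to 1 on [(q, 1)].  The
    equation [h r = s] is quadratic in [r], so the inverse is explicit, and
    both maps are built from the coordinates by field operations and square
    roots of positive quantities.  Functions of that kind are smooth because
    they are closed under partial differentiation
    ([elementary_ex_diff_n]). *)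

(** * Smoothness of functions built by field operations and square roots *)

Definition open_set (U : C -> Prop) : Prop :=
  forall x y, U (x, y) -> locally_2d (fun s t => U (s, t)) x y.

Lemma is_derive_Rmult (f g : R -> R) (x df dg : R) :
  is_derive f x df -> is_derive g x dg ->
  is_derive (fun t => f t * g t) x (df * g x + f x * dg).
Proof.
  intros Hf Hg. apply (is_derive_mult f g); trivial. apply Rmult_comm.
Qed.

(** The two side conditions are required on all of [U], so that membership is
    a statement about the whole domain and is inherited by the partial
    derivatives. *)
Inductive elementary (U : C -> Prop) : (R -> R -> R) -> Prop :=
| el_const (c : R) : elementary U (fun _ _ => c)
| el_fst : elementary U (fun x _ => x)
| el_snd : elementary U (fun _ y => y)
| el_plus f g : elementary U f -> elementary U g ->
    elementary U (fun x y => f x y + g x y)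
| el_mult f g : elementary U f -> elementary U g ->
    elementary U (fun x y => f x y * g x y)
| el_inv f : elementary U f -> (forall x y, U (x, y) -> f x y <> 0) ->
    elementary U (fun x y => / f x y)
| el_sqrt f : elementary U f -> (forall x y, U (x, y) -> 0 < f x y) ->
    elementary U (fun x y => sqrt (f x y)).

Lemma elementary_continuous U f :
  elementary U f -> forall x y, U (x, y) -> continuity_2d_pt f x y.
Proof.
  induction 1 as [c | | | f g Hf IHf Hg IHg | f g Hf IHf Hg IHg
                 | f Hf IHf Hn | f Hf IHf Hp]; intros x y Hxy.
  - apply continuity_2d_pt_const.
  - apply continuity_2d_pt_id1.
  - apply continuity_2d_pt_id2.
  - apply continuity_2d_pt_plus; auto.
  - apply continuity_2d_pt_mult; auto.
  - apply continuity_2d_pt_inv; auto.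
  - apply continuity_1d_2d_pt_comp; auto.
    apply continuity_pt_sqrt. apply Rlt_le; auto.
Qed.

(** Closure of the class under differentiation is what allows an induction on
    the order of smoothness: the derivative of an inverse or of a square root
    needs only inverses of functions that are nonzero on [U]. *)
Lemma elementary_partials U f :
  elementary U f ->
  exists fx fy, elementary U fx /\ elementary U fy /\
    forall x y, U (x, y) ->
      is_derive (fun t => f t y) x (fx x y) /\
      is_derive (fun t => f x t) y (fy x y).
Proof.
  induction 1 as [c | | | f g Hf IHf Hg IHg | f g Hf IHf Hg IHg
                 | f Hf IHf Hn | f Hf IHf Hp].
  - exists (fun _ _ => 0), (fun _ _ => 0).
    split; [constructor | split; [constructor |]]; intros x y _; split;
      apply @is_derive_const.
  - exists (fun _ _ => 1), (fun _ _ => 0).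
    split; [constructor | split; [constructor |]]; intros x y _; split;
      [apply @is_derive_id | apply @is_derive_const].
  - exists (fun _ _ => 0), (fun _ _ => 1).
    split; [constructor | split; [constructor |]]; intros x y _; split;
      [apply @is_derive_const | apply @is_derive_id].
  - destruct IHf as (fx & fy & Efx & Efy & Df).
    destruct IHg as (gx & gy & Egx & Egy & Dg).
    exists (fun x y => fx x y + gx x y), (fun x y => fy x y + gy x y).
    split; [|split]; [constructor; assumption .. |].
    intros x y Hxy. destruct (Df x y Hxy), (Dg x y Hxy).
    split;
      [apply (is_derive_plus (fun t => f t y) (fun t => g t y))
      |apply (is_derive_plus (fun t => f x t) (fun t => g x t))]; trivial.
  - destruct IHf as (fx & fy & Efx & Efy & Df).
    destruct IHg as (gx & gy & Egx & Egy & Dg).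
    exists (fun x y => fx x y * g x y + f x y * gx x y),
           (fun x y => fy x y * g x y + f x y * gy x y).
    split; [|split]; [repeat constructor; assumption .. |].
    intros x y Hxy. destruct (Df x y Hxy), (Dg x y Hxy).
    split;
      [apply (is_derive_Rmult (fun t => f t y) (fun t => g t y))
      |apply (is_derive_Rmult (fun t => f x t) (fun t => g x t))]; trivial.
  - destruct IHf as (fx & fy & Efx & Efy & Df).
    exists (fun x y => (-1 * fx x y) * / (f x y * f x y)),
           (fun x y => (-1 * fy x y) * / (f x y * f x y)).
    assert (Hn2 : forall x y, U (x, y) -> f x y * f x y <> 0)
      by (intros x y Hxy; apply Rmult_integral_contrapositive_currified; auto).
    split; [|split];
      [constructor; repeat constructor; assumption .. |].
    intros x y Hxy. destruct (Df x y Hxy) as [Dx Dy].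
    split.
    + replace (-1 * fx x y * / (f x y * f x y))
        with (- fx x y / f x y ^ 2) by (field; auto).
      apply (is_derive_inv (fun t => f t y)); auto.
    + replace (-1 * fy x y * / (f x y * f x y))
        with (- fy x y / f x y ^ 2) by (field; auto).
      apply (is_derive_inv (fun t => f x t)); auto.
  - destruct IHf as (fx & fy & Efx & Efy & Df).
    exists (fun x y => fx x y * / (2 * sqrt (f x y))),
           (fun x y => fy x y * / (2 * sqrt (f x y))).
    assert (Hs : forall x y, U (x, y) -> 2 * sqrt (f x y) <> 0).
    { intros x y Hxy. pose proof (sqrt_lt_R0 _ (Hp x y Hxy)). lra. }
    split; [|split];
      [constructor; repeat constructor; assumption .. |].
    intros x y Hxy. destruct (Df x y Hxy) as [Dx Dy].
    split.
    + apply (is_derive_sqrt (fun t => f t y)); auto.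
    + apply (is_derive_sqrt (fun t => f x t)); auto.
Qed.

(** Openness of [U] enters because [ex_diff_n] speaks of [Derive] as a
    function, which has to agree with the elementary partial derivative near
    the point and not only at it. *)
Lemma elementary_ex_diff_n U f n x y :
  open_set U -> elementary U f -> U (x, y) -> ex_diff_n f n x y.
Proof.
  intros HU. revert f x y.
  induction n as [|n IHn]; intros f x y Ef Hxy; simpl.
  - split; [apply (elementary_continuous U) | ]; trivial.
  - destruct (elementary_partials U f Ef) as (fx & fy & Efx & Efy & Df).
    destruct (Df x y Hxy) as [Dx Dy].
    split; [apply (elementary_continuous U); trivial |].
    split; [eexists; apply Dx |]. split; [eexists; apply Dy |].
    split.
    + apply ex_diff_n_ext_loc with fx; [| apply IHn; trivial].
      apply locally_2d_impl with (2 := HU x y Hxy), locally_2d_forall.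
      intros s t Hst. symmetry. apply is_derive_unique. apply (Df s t Hst).
    + apply ex_diff_n_ext_loc with fy; [| apply IHn; trivial].
      apply locally_2d_impl with (2 := HU x y Hxy), locally_2d_forall.
      intros s t Hst. symmetry. apply is_derive_unique. apply (Df s t Hst).
Qed.

(** * Concentric round domains *)

(** The punctured disk is the case [lo = 0] and the annulus the case
    [lo = exp (- a)], which gives both domains a common treatment. *)
Definition shell (lo : R) (z : C) : Prop := lo < Cmod z < 1.

Lemma Cmod_radicand_pos x y : 0 < Cmod (x, y) -> 0 < x ^ 2 + y ^ 2.
Proof.
  intros H. destruct (Rle_or_lt (x ^ 2 + y ^ 2) 0) as [H0|H0]; trivial.
  change (0 < sqrt (x ^ 2 + y ^ 2)) in H. rewrite (sqrt_neg_0 _ H0) in H. lra.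
Qed.

Lemma Cmod_elementary lo : 0 <= lo -> elementary (shell lo) (fun x y => Cmod (x, y)).
Proof.
  intros Hlo. apply (el_sqrt _ (fun x y => x ^ 2 + y ^ 2)).
  - apply el_plus; repeat constructor.
  - intros x y [Hxy _]. apply Cmod_radicand_pos. lra.
Qed.

Lemma shell_open lo : 0 <= lo -> open_set (shell lo).
Proof.
  intros Hlo x y Hxy.
  pose proof (elementary_continuous _ _ (Cmod_elementary lo Hlo) x y Hxy) as Hc.
  assert (He : 0 < Rmin (Cmod (x, y) - lo) (1 - Cmod (x, y)))
    by (destruct Hxy; apply Rmin_glb_lt; lra).
  destruct (Hc (mkposreal _ He)) as [d Hd]. exists d.
  intros s t Hs Ht. specialize (Hd s t Hs Ht). simpl in Hd.
  apply Rabs_def2 in Hd.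
  pose proof (Rmin_l (Cmod (x, y) - lo) (1 - Cmod (x, y))).
  pose proof (Rmin_r (Cmod (x, y) - lo) (1 - Cmod (x, y))).
  unfold shell. lra.
Qed.

Lemma punctured_disk_shell z : punctured_disk z <-> shell 0 z.
Proof.
  unfold punctured_disk, shell. rewrite (Cmod_gt_0 z). tauto.
Qed.

Lemma annulus_shell a z : annulus a z <-> shell (exp (- a)) z.
Proof.
  unfold annulus, shell. lra.
Qed.

(** * Radial maps *)

Definition radial (phi : R -> R) (z : C) : C :=
  (Re z * phi (Cmod z), Im z * phi (Cmod z)).

Lemma radial_smooth lo phi :
  0 <= lo -> elementary (shell lo) (fun x y => phi (Cmod (x, y))) ->
  forall n, Cn_on (shell lo) n (radial phi).
Proof.
  intros Hlo Hphi n [x y] Hxy. split.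
  - apply (elementary_ex_diff_n (shell lo) (fun x y => x * phi (Cmod (x, y))));
      [apply shell_open; trivial | repeat constructor; trivial | trivial].
  - apply (elementary_ex_diff_n (shell lo) (fun x y => y * phi (Cmod (x, y))));
      [apply shell_open; trivial | repeat constructor; trivial | trivial].
Qed.

Lemma Cmod_radial phi z :
  0 <= phi (Cmod z) -> Cmod (radial phi z) = Cmod z * phi (Cmod z).
Proof.
  intros Hp. replace (radial phi z) with (Cmult z (RtoC (phi (Cmod z)))).
  - rewrite Cmod_mult, Cmod_R, Rabs_pos_eq; trivial.
  - unfold radial, Cmult. simpl. f_equal; unfold Re, Im; ring.
Qed.

(** A nonnegative factor also multiplies the modulus, so the composition
    multiplies [z] by the factor of [psi] at [|z| phi |z|] times that of
    [phi] at [|z|]. *)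
Lemma radial_radial phi psi z :
  0 <= phi (Cmod z) -> phi (Cmod z) * psi (Cmod z * phi (Cmod z)) = 1 ->
  radial psi (radial phi z) = z.
Proof.
  intros Hp H. unfold radial at 1. rewrite Cmod_radial by trivial.
  destruct z as [x y]; unfold radial; simpl.
  f_equal; unfold Re, Im in *; simpl; rewrite Rmult_assoc, H; ring.
Qed.

Lemma polar_surjective z : exists theta, z = polar (Cmod z) theta.
Proof.
  destruct (Req_dec (Cmod z) 0) as [H0|H0].
  { exists 0. rewrite H0. apply Cmod_eq_0 in H0. subst z.
    unfold polar. now rewrite Cmult_0_l. }
  destruct z as [x y].
  pose proof (Cmod_ge_0 (x, y)) as Hge.
  pose proof (Cmod2_alt (x, y)) as H2. simpl Re in H2; simpl Im in H2.
  revert H0 Hge H2. generalize (Cmod (x, y)). intros r H0 Hge H2.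
  assert (Hr : 0 < r) by lra.
  assert (Hx : (x / r) ^ 2 <= 1).
  { replace ((x / r) ^ 2) with (x ^ 2 / r ^ 2) by (field; lra).
    replace (x ^ 2) with (r ^ 2 - y ^ 2) by lra.
    replace ((r ^ 2 - y ^ 2) / r ^ 2) with (1 - (y / r) ^ 2) by (field; lra).
    pose proof (pow2_ge_0 (y / r)). lra. }
  assert (Hb : -1 <= x / r <= 1) by nra.
  assert (Hsin : sin (acos (x / r)) = Rabs y / r).
  { rewrite sin_acos by trivial.
    replace (1 - (x / r)²) with ((Rabs y / r)²).
    - apply sqrt_Rsqr. apply Rmult_le_pos; [apply Rabs_pos |].
      apply Rlt_le, Rinv_0_lt_compat; trivial.
    - rewrite 2!Rsqr_div', <- Rsqr_abs. unfold Rsqr.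
      replace (y * y) with (r * r - x * x) by lra. field; lra. }
  destruct (Rle_or_lt 0 y) as [Hy|Hy].
  - exists (acos (x / r)). unfold polar, Cmult, RtoC; simpl.
    rewrite Hsin, cos_acos, Rabs_pos_eq by trivial. f_equal; field; trivial.
  - exists (- acos (x / r)). unfold polar, Cmult, RtoC; simpl.
    rewrite sin_neg, cos_neg, Hsin, cos_acos, Rabs_left by trivial.
    f_equal; field; trivial.
Qed.

Lemma polar_0 r : polar r 0 = (r, 0).
Proof.
  unfold polar, Cmult, RtoC; simpl. rewrite cos_0, sin_0. f_equal; ring.
Qed.

Lemma Cmod_real r : 0 <= r -> Cmod (r, 0) = r.
Proof.
  intros Hr. change (r, 0) with (RtoC r). rewrite Cmod_R. now apply Rabs_pos_eq.
Qed.

Lemma Cmod_polar r theta : 0 <= r -> Cmod (polar r theta) = r.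
Proof.
  intros Hr. unfold polar. rewrite Cmod_mult, Cmod_R, Rabs_pos_eq by trivial.
  replace (Cmod (cos theta, sin theta)) with 1; [ring |].
  unfold Cmod; simpl fst; simpl snd.
  rewrite <- !Rsqr_pow2, Rplus_comm, sin2_cos2. now rewrite sqrt_1.
Qed.

Lemma radial_polar phi r theta :
  0 <= r -> radial phi (polar r theta) = polar (r * phi r) theta.
Proof.
  intros Hr. unfold radial. rewrite Cmod_polar by trivial.
  unfold polar, Cmult, RtoC; simpl. f_equal; ring.
Qed.

(** The profile [h] is recovered from the values of [u] on the positive real
    axis, so it inherits the regularity of [u]; the definition of rotational
    symmetry by itself gives [h] none. *)
Lemma rot_symmetric_radial lo u :
  0 <= lo -> rot_symmetric (shell lo) u ->
  forall z, shell lo z -> u z = radial (fun r => Re (u (r, 0)) / r) z.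
Proof.
  intros Hlo [h Hh] z Hz.
  assert (Hr : 0 < Cmod z) by (destruct Hz; lra).
  assert (Hre : Re (u (Cmod z, 0)) = h (Cmod z)).
  { destruct (Hh (Cmod z) 0 Hr) as [_ E].
    - rewrite polar_0. unfold shell. rewrite Cmod_real; [exact Hz | lra].
    - rewrite !polar_0 in E. now rewrite E. }
  destruct (polar_surjective z) as [theta Ez].
  rewrite Ez in Hz. destruct (Hh _ theta Hr Hz) as [_ E].
  rewrite Ez at 1 2. rewrite E, radial_polar, Hre by lra.
  f_equal. field. lra.
Qed.

Lemma rot_symmetric_radius lo u :
  0 <= lo -> rot_symmetric (shell lo) u ->
  forall r, lo < r < 1 -> 0 < Re (u (r, 0)) /\ Cmod (u (r, 0)) = Re (u (r, 0)).
Proof.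
  intros Hlo [h Hh] r Hr.
  destruct (Hh r 0) as [Hp E]; [lra | |].
  - rewrite polar_0. unfold shell. rewrite Cmod_real; lra.
  - rewrite !polar_0 in E. rewrite E. simpl. rewrite Cmod_real; lra.
Qed.

(** * Wirtinger derivatives of radial maps *)

Section Derivatives.
Variables x y : R.
Hypothesis Hxy : 0 < Cmod (x, y).

Lemma is_derive_Cmod_x : is_derive (fun t => Cmod (t, y)) x (x / Cmod (x, y)).
Proof.
  replace (x / Cmod (x, y)) with (2 * x / (2 * Cmod (x, y))) by (field; lra).
  apply (is_derive_sqrt (fun t => t ^ 2 + y ^ 2));
    [auto_derive; trivial; ring | apply Cmod_radicand_pos, Hxy].
Qed.

Lemma is_derive_Cmod_y : is_derive (fun t => Cmod (x, t)) y (y / Cmod (x, y)).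
Proof.
  replace (y / Cmod (x, y)) with (2 * y / (2 * Cmod (x, y))) by (field; lra).
  apply (is_derive_sqrt (fun t => x ^ 2 + t ^ 2));
    [auto_derive; trivial; ring | apply Cmod_radicand_pos, Hxy].
Qed.

End Derivatives.

Lemma partial_x_eq u f g x y lf lg :
  locally_2d (fun s t => u (s, t) = (f s t, g s t)) x y ->
  is_derive (fun s => f s y) x lf -> is_derive (fun s => g s y) x lg ->
  partial_x u (x, y) = (lf, lg).
Proof.
  intros Hu Hf Hg. apply locally_2d_1d_const_y in Hu. unfold partial_x; simpl.
  f_equal; apply is_derive_unique.
  - apply is_derive_ext_loc with (2 := Hf).
    apply filter_imp with (2 := Hu). now intros s ->.
  - apply is_derive_ext_loc with (2 := Hg).
    apply filter_imp with (2 := Hu). now intros s ->.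
Qed.

Lemma partial_y_eq u f g x y lf lg :
  locally_2d (fun s t => u (s, t) = (f s t, g s t)) x y ->
  is_derive (fun t => f x t) y lf -> is_derive (fun t => g x t) y lg ->
  partial_y u (x, y) = (lf, lg).
Proof.
  intros Hu Hf Hg. apply locally_2d_1d_const_x in Hu. unfold partial_y; simpl.
  f_equal; apply is_derive_unique.
  - apply is_derive_ext_loc with (2 := Hf).
    apply filter_imp with (2 := Hu). now intros s ->.
  - apply is_derive_ext_loc with (2 := Hg).
    apply filter_imp with (2 := Hu). now intros s ->.
Qed.

Lemma is_derive_comp_Cmod_x G x y l :
  0 < Cmod (x, y) -> is_derive G (Cmod (x, y)) l ->
  is_derive (fun s => G (Cmod (s, y))) x (x / Cmod (x, y) * l).
Proof.
  intros Hp HG.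
  exact (is_derive_comp G (fun s => Cmod (s, y)) x _ _ HG (is_derive_Cmod_x x y Hp)).
Qed.

Lemma is_derive_comp_Cmod_y G x y l :
  0 < Cmod (x, y) -> is_derive G (Cmod (x, y)) l ->
  is_derive (fun t => G (Cmod (x, t))) y (y / Cmod (x, y) * l).
Proof.
  intros Hp HG.
  exact (is_derive_comp G (fun s => Cmod (x, s)) y _ _ HG (is_derive_Cmod_y x y Hp)).
Qed.

Lemma Cmod_sqr x y : Cmod (x, y) * Cmod (x, y) = x * x + y * y.
Proof.
  pose proof (Cmod2_alt (x, y)) as H. simpl in H. lra.
Qed.

(** The angular parts of the four partial derivatives cancel: the imaginary
    part is [(x y - x y) l / |z|], and in the real part [x^2 + y^2] recombines
    into [|z|^2]. *)
Lemma d_z_radial u phi x y l :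
  0 < Cmod (x, y) ->
  locally_2d (fun s t => u (s, t) = radial phi (s, t)) x y ->
  is_derive phi (Cmod (x, y)) l ->
  d_z u (x, y) = RtoC (phi (Cmod (x, y)) + Cmod (x, y) * l / 2).
Proof.
  intros Hp Hu Hphi.
  pose proof (is_derive_comp_Cmod_x phi x y l Hp Hphi) as Dx.
  pose proof (is_derive_comp_Cmod_y phi x y l Hp Hphi) as Dy.
  unfold d_z.
  rewrite (partial_x_eq u _ _ x y _ _ Hu
    (is_derive_Rmult (fun s => s) _ x _ _ (is_derive_id x) Dx)
    (is_derive_Rmult (fun _ => y) _ x _ _ (is_derive_const y x) Dx)).
  rewrite (partial_y_eq u _ _ x y _ _ Hu
    (is_derive_Rmult (fun _ => x) _ y _ _ (is_derive_const x y) Dy)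
    (is_derive_Rmult (fun t => t) _ y _ _ (is_derive_id y) Dy)).
  pose proof (Cmod_sqr x y) as H2.
  unfold Cdiv, Cinv, Cmult, Cminus, Cplus, Copp, Ci, RtoC, zero, one; simpl.
  revert Hp H2. generalize (Cmod (x, y)). intros r Hp H2.
  f_equal.
  - replace (r * l / 2) with (r * r * l / (2 * r)) by (field; lra).
    rewrite H2. field; lra.
  - field; lra.
Qed.

Lemma d_zbar_of_modulus w G x y m :
  0 < Cmod (x, y) ->
  locally_2d (fun s t => w (s, t) = RtoC (G (Cmod (s, t)))) x y ->
  is_derive G (Cmod (x, y)) m ->
  d_zbar w (x, y) = (x * m / (2 * Cmod (x, y)), y * m / (2 * Cmod (x, y))).
Proof.
  intros Hp Hw HG.
  pose proof (is_derive_comp_Cmod_x G x y m Hp HG) as Dx.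
  pose proof (is_derive_comp_Cmod_y G x y m Hp HG) as Dy.
  unfold d_zbar.
  rewrite (partial_x_eq w _ _ x y _ _ Hw Dx (is_derive_const 0 x)).
  rewrite (partial_y_eq w _ _ x y _ _ Hw Dy (is_derive_const 0 y)).
  unfold Cdiv, Cinv, Cmult, Cplus, Ci, RtoC, zero; simpl.
  f_equal; field; lra.
Qed.

(** The density of the flat metric has zero derivative, so only the linear
    part of the harmonic map equation remains. *)
Lemma euclidean_harmonic_term u z :
  Cplus (d_zbar (d_z u) z)
      (Cmult
         (Cdiv (Cmult (RtoC 2) (d_z (fun w => RtoC (euclidean w)) (u z)))
               (RtoC (euclidean (u z))))
         (Cmult (d_z u z) (d_zbar u z))) = d_zbar (d_z u) z.
Proof.
  assert (H : forall w, d_z (fun w => RtoC (euclidean w)) w = RtoC 0).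
  { intros w. unfold d_z, partial_x, partial_y, euclidean; simpl.
    rewrite !Derive_const.
    unfold Cdiv, Cinv, Cmult, Cminus, Cplus, Copp, Ci, RtoC; simpl. f_equal; field. }
  rewrite H. unfold Cdiv. rewrite Cmult_0_r, !Cmult_0_l. apply Cplus_0_r.
Qed.

(** * Harmonic profiles and the nonexistence half *)

Lemma constant_of_zero_derivative f lo hi :
  (forall t, lo < t < hi -> is_derive f t 0) ->
  forall x y, lo < x < hi -> lo < y < hi -> f x = f y.
Proof.
  intros Hf x y Hx Hy.
  destruct (Rtotal_order x y) as [H|[->|H]]; trivial.
  - apply (eq_is_derive f x y); trivial. intros t Ht. apply Hf. lra.
  - symmetry. apply (eq_is_derive f y x); trivial. intros t Ht. apply Hf. lra.
Qed.

(** Integrating twice: first [G = (h' + h / r) / 2] is constant because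
    [d_zbar] annihilates [d_z u = G |z|]; then [r h - c r^2] is constant
    because its derivative is [2 r (G - c)]. *)
Lemma rot_symmetric_harmonic_profile lo V u :
  0 <= lo < 1 -> rot_symmetric (shell lo) u ->
  harmonic_map (shell lo) V euclidean u ->
  exists c b, forall r, lo < r < 1 -> r * Re (u (r, 0)) = c * r ^ 2 + b.
Proof.
  intros Hlo Hrot (_ & Hreg & Hharm).
  set (h := fun r => Re (u (r, 0))).
  assert (Hreal : forall r, lo < r < 1 -> shell lo (r, 0))
    by (intros r Hr; unfold shell; rewrite Cmod_real; lra).
  assert (Dh : forall r, lo < r < 1 -> is_derive h r (Derive h r)).
  { intros r Hr. apply Derive_correct.
    apply (Hreg _ (Hreal r Hr)). }
  assert (Dh' : forall r, lo < r < 1 ->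
                is_derive (Derive h) r (Derive (Derive h) r)).
  { intros r Hr. apply Derive_correct.
    destruct (Hreg _ (Hreal r Hr)) as [(_ & _ & _ & (_ & H & _) & _) _].
    exact H. }
  assert (Dq : forall r, lo < r < 1 ->
      is_derive (fun t => h t / t) r ((Derive h r * r - h r) / r ^ 2)).
  { intros r Hr.
    replace ((Derive h r * r - h r) / r ^ 2)
      with (Derive h r * / r + h r * (- 1 / r ^ 2)) by (field; lra).
    apply is_derive_Rmult; [apply Dh; trivial |].
    apply (is_derive_inv (fun t => t)); [apply @is_derive_id | lra]. }
  set (G := fun r => / 2 * (Derive h r + h r / r)).
  assert (Hdz : forall s t, shell lo (s, t) ->
                d_z u (s, t) = RtoC (G (Cmod (s, t)))).
  { intros s t Hst.
    rewrite d_z_radial with (3 := Dq _ Hst).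
    - f_equal. unfold G. destruct Hst. field. lra.
    - destruct Hst. lra.
    - apply locally_2d_impl with (2 := shell_open lo (proj1 Hlo) s t Hst).
      apply locally_2d_forall. intros s' t' H.
      apply (rot_symmetric_radial lo); trivial. lra. }
  assert (DG : forall r, lo < r < 1 -> is_derive G r 0).
  { intros r Hr.
    assert (exists m : R, is_derive G r m) as [m D].
    { eexists. apply (is_derive_scal (fun r => Derive h r + h r / r)).
      apply (is_derive_plus (Derive h) (fun t => h t / t)); auto. }
    specialize (Hharm _ (Hreal r Hr)). rewrite euclidean_harmonic_term in Hharm.
    rewrite <- (Cmod_real r) in D at 1 by lra.
    rewrite d_zbar_of_modulus with (3 := D) in Hharm.
    - apply (f_equal Re) in Hharm. simpl in Hharm.
      rewrite Cmod_real in Hharm, D by lra.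
      assert (m = 0) as <-; [| exact D].
      transitivity (2 * (r * m / (2 * r))); [field; lra |].
      rewrite Hharm. ring.
    - rewrite Cmod_real; lra.
    - apply locally_2d_impl with (2 := shell_open lo (proj1 Hlo) r 0 (Hreal r Hr)).
      apply locally_2d_forall. exact Hdz. }
  (* Any base point of the interval would do to name the two constants. *)
  set (r0 := (lo + 1) / 2). assert (Hr0 : lo < r0 < 1) by (unfold r0; lra).
  set (F := fun r => r * h r + - G r0 * r ^ 2).
  assert (DF : forall r, lo < r < 1 -> is_derive F r 0).
  { intros r Hr.
    replace 0 with ((1 * h r + r * Derive h r) + - G r0 * (2 * r)).
    - apply (is_derive_plus (fun r => r * h r) (fun r => - G r0 * r ^ 2)).
      + apply (is_derive_Rmult (fun r => r)); [apply @is_derive_id | auto].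
      + apply (is_derive_scal (fun r => r ^ 2)). auto_derive; trivial. ring.
    - rewrite (constant_of_zero_derivative G lo 1 DG r0 r) by trivial.
      unfold G. field. lra. }
  exists (G r0), (F r0). intros r Hr. fold (h r).
  rewrite (constant_of_zero_derivative F lo 1 DF r0 r) by trivial.
  unfold F. ring.
Qed.

(** An explicit form of letting [x] tend to 0. *)
Lemma nonpos_of_small_multiples b K :
  (forall x, 0 < x < 1 -> b <= K * x) -> b <= 0.
Proof.
  intros H. destruct (Rle_or_lt b 0) as [Hb|Hb]; trivial.
  assert (HK : 0 < K) by (assert (b <= K * (1 / 2)) by (apply H; lra); lra).
  (* The denominator keeps the test point below 1 and makes [K x] less than
     [b]. *)
  assert (Hx : 0 < b / (2 * (K + b)) < 1).
  { split.
    - apply Rdiv_lt_0_compat; lra.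
    - apply Rlt_div_l; lra. }
  specialize (H _ Hx).
  assert (E : K * (b / (2 * (K + b))) = b * (K / (2 * (K + b)))) by (field; lra).
  rewrite E in H.
  assert (K / (2 * (K + b)) < 1) by (apply Rlt_div_l; lra).
  nra.
Qed.

(** Near the puncture [h = c r + b / r] is unbounded unless [b = 0], and then
    it tends to 0; a profile with values in [(q, 1)] allows neither. *)
Lemma no_rot_symmetric_harmonic_map_into_annulus q u :
  0 < q -> rot_symmetric (shell 0) u ->
  ~ harmonic_map (shell 0) (shell q) euclidean u.
Proof.
  intros Hq Hrot Hharm.
  assert (Hb : forall r, 0 < r < 1 -> q < Re (u (r, 0)) < 1).
  { intros r Hr.
    destruct (rot_symmetric_radius 0 u (Rle_refl 0) Hrot r Hr) as [_ <-].
    apply (proj1 Hharm). unfold shell. rewrite Cmod_real; lra. }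
  destruct (rot_symmetric_harmonic_profile 0 (shell q) u)
    as (c & b & E); [lra | trivial .. |].
  assert (Hb0 : Rabs b <= 0).
  { apply nonpos_of_small_multiples with (K := 1 + Rabs c).
    intros x Hx. specialize (Hb x Hx). specialize (E x Hx).
    replace b with (x * Re (u (x, 0)) - c * x ^ 2) by lra.
    eapply Rle_trans; [apply Rabs_triang |].
    rewrite Rabs_Ropp, !Rabs_mult, (Rabs_pos_eq x), (Rabs_pos_eq (x ^ 2)),
      (Rabs_pos_eq (Re _)) by nra.
    assert (Rabs c * x ^ 2 <= Rabs c * x)
      by (apply Rmult_le_compat_l; [apply Rabs_pos | nra]).
    nra. }
  assert (b = 0) as -> by (destruct (Req_dec b 0) as [|H]; trivial;
                           apply Rabs_pos_lt in H; lra).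
  assert (q <= 0); [| lra].
  apply nonpos_of_small_multiples with (K := c).
  intros x Hx. specialize (Hb x Hx). specialize (E x Hx).
  assert (Re (u (x, 0)) = c * x) by (apply (Rmult_eq_reg_l x); lra). lra.
Qed.

(** * The explicit harmonic diffeomorphism *)

(** The factor [h r / r] for [h r = (r - q^2 / r) / (1 - q^2)], the only
    harmonic profile with [h q = 0] and [h 1 = 1]. *)
Definition stretch (q r : R) : R := (1 + - q ^ 2 / (r * r)) / (1 - q ^ 2).

(** The factor [r / s], where [r] is the positive root of
    [r^2 - (1 - q^2) s r - q^2 = 0], the equation [h r = s] cleared of
    denominators.  Dividing the root by [s] puts [s] under the square root. *)
Definition unstretch (q s : R) : R :=
  ((1 - q ^ 2) + sqrt ((1 - q ^ 2) * (1 - q ^ 2) + 4 * q ^ 2 / (s * s))) / 2.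

Section Stretch.
Variable q : R.
Hypothesis Hq : 0 < q < 1.

Lemma one_minus_q2_pos : 0 < 1 - q ^ 2.
Proof. nra. Qed.

Lemma stretch_pos r : q < r -> 0 < stretch q r.
Proof.
  intros Hr. pose proof one_minus_q2_pos.
  unfold stretch. apply Rdiv_lt_0_compat; trivial.
  replace (1 + - q ^ 2 / (r * r)) with ((r ^ 2 - q ^ 2) / (r * r)) by (field; lra).
  apply Rdiv_lt_0_compat; nra.
Qed.

Lemma unstretch_radicand_pos s :
  0 < s -> 0 < (1 - q ^ 2) * (1 - q ^ 2) + 4 * q ^ 2 / (s * s).
Proof.
  intros Hs. pose proof one_minus_q2_pos.
  assert (0 < 4 * q ^ 2 / (s * s)) by (apply Rdiv_lt_0_compat; nra). nra.
Qed.

Lemma unstretch_pos s : 0 < s -> 0 < unstretch q s.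
Proof.
  intros Hs. pose proof one_minus_q2_pos. unfold unstretch.
  pose proof (sqrt_lt_R0 _ (unstretch_radicand_pos s Hs)). lra.
Qed.

(** With [s = h r], the radicand is a perfect square: it equals
    [((r + q^2 / r) / s)^2], because [(r - q^2 / r)^2 + 4 q^2] is
    [(r + q^2 / r)^2]. *)
Lemma unstretch_stretch r :
  q < r -> stretch q r * unstretch q (r * stretch q r) = 1.
Proof.
  intros Hr. pose proof (stretch_pos r Hr) as Hp. pose proof one_minus_q2_pos as Hk.
  set (s := r * stretch q r).
  assert (Hs : 0 < s) by (apply Rmult_lt_0_compat; lra).
  assert (Es : (1 - q ^ 2) * s = r - q ^ 2 / r)
    by (unfold s, stretch; field; lra).
  assert (Ed : sqrt ((1 - q ^ 2) * (1 - q ^ 2) + 4 * q ^ 2 / (s * s))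
               = (r + q ^ 2 / r) / s).
  { replace ((1 - q ^ 2) * (1 - q ^ 2) + 4 * q ^ 2 / (s * s))
      with ((((1 - q ^ 2) * s) * ((1 - q ^ 2) * s) + 4 * q ^ 2) / (s * s))
      by (field; lra).
    rewrite Es. apply sqrt_lem_1.
    - rewrite <- Es. apply Rlt_le, Rdiv_lt_0_compat; [| nra].
      apply Rplus_le_lt_0_compat; [apply Rle_0_sqr | nra].
    - apply Rlt_le, Rdiv_lt_0_compat; trivial.
      assert (0 < q ^ 2 / r) by (apply Rdiv_lt_0_compat; nra). lra.
    - field. lra. }
  unfold unstretch. rewrite Ed.
  replace (1 - q ^ 2 + (r + q ^ 2 / r) / s)
    with (((1 - q ^ 2) * s + (r + q ^ 2 / r)) / s) by (field; lra).
  rewrite Es. unfold s. field. lra.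
Qed.

Lemma unstretch_quadratic s :
  0 < s -> let r := s * unstretch q s in
  r ^ 2 - (1 - q ^ 2) * s * r - q ^ 2 = 0.
Proof.
  intros Hs r. unfold r, unstretch.
  pose proof (sqrt_sqrt _ (Rlt_le _ _ (unstretch_radicand_pos s Hs))) as Hd.
  set (d := sqrt _) in *.
  replace ((s * ((1 - q ^ 2 + d) / 2)) ^ 2
           - (1 - q ^ 2) * s * (s * ((1 - q ^ 2 + d) / 2)))
    with (s ^ 2 * (d * d - (1 - q ^ 2) * (1 - q ^ 2)) / 4) by field.
  rewrite Hd. field. lra.
Qed.

Lemma stretch_unstretch s :
  0 < s -> unstretch q s * stretch q (s * unstretch q s) = 1.
Proof.
  intros Hs. pose proof (unstretch_quadratic s Hs) as E; cbv zeta in E.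
  pose proof (unstretch_pos s Hs) as Hp. pose proof one_minus_q2_pos.
  set (r := s * unstretch q s) in *.
  assert (Hr : 0 < r) by (apply Rmult_lt_0_compat; lra).
  unfold stretch.
  replace (1 + - q ^ 2 / (r * r)) with ((r ^ 2 - q ^ 2) / (r * r)) by (field; lra).
  replace (r ^ 2 - q ^ 2) with ((1 - q ^ 2) * s * r) by lra.
  unfold r. field. lra.
Qed.

Lemma stretch_bound r : q < r < 1 -> r * stretch q r < 1.
Proof.
  intros Hr. pose proof one_minus_q2_pos.
  replace (r * stretch q r) with ((r ^ 2 - q ^ 2) / (r * (1 - q ^ 2)))
    by (unfold stretch; field; lra).
  apply Rlt_div_l; nra.
Qed.

(** The root [r] satisfies [r^2 - q^2 = (1 - q^2) s r > 0].  If [r >= 1], then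
    [s < 1] would make [r^2 - (1 - q^2) s r - q^2] larger than its value at
    [s = 1], which is [(r - 1) (r + q^2) >= 0]. *)
Lemma unstretch_bounds s : 0 < s < 1 -> q < s * unstretch q s < 1.
Proof.
  intros Hs. pose proof (unstretch_quadratic s (proj1 Hs)) as E; cbv zeta in E.
  pose proof (unstretch_pos s (proj1 Hs)) as Hp. pose proof one_minus_q2_pos.
  set (r := s * unstretch q s) in *.
  assert (Hr : 0 < r) by (apply Rmult_lt_0_compat; lra).
  clearbody r.
  assert (0 < (1 - q ^ 2) * s * r) by (repeat apply Rmult_lt_0_compat; lra).
  split; [nra |].
  destruct (Rlt_or_le r 1) as [|H1]; trivial.
  assert (0 < (1 - q ^ 2) * r * (1 - s)) by (repeat apply Rmult_lt_0_compat; lra).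
  assert (0 <= (r - 1) * (r + q ^ 2)) by (apply Rmult_le_pos; nra).
  lra.
Qed.

Lemma stretch_elementary :
  elementary (shell q) (fun x y => stretch q (Cmod (x, y))).
Proof.
  assert (Hq0 : 0 <= q) by lra.
  pose proof (Cmod_elementary q Hq0) as Em.
  refine (el_mult _ _ _ (el_plus _ _ _ (el_const _ 1)
           (el_mult _ _ _ (el_const _ (- q ^ 2))
             (el_inv _ _ (el_mult _ _ _ Em Em) _))) (el_const _ (/ (1 - q ^ 2)))).
  intros x y [Hxy _]. nra.
Qed.

Lemma unstretch_elementary :
  elementary (shell 0) (fun x y => unstretch q (Cmod (x, y))).
Proof.
  pose proof (Cmod_elementary 0 (Rle_refl 0)) as Em.
  refine (el_mult _ _ _ (el_plus _ _ _ (el_const _ (1 - q ^ 2))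
           (el_sqrt _ _ (el_plus _ _ _ (el_const _ ((1 - q ^ 2) * (1 - q ^ 2)))
             (el_mult _ _ _ (el_const _ (4 * q ^ 2))
               (el_inv _ _ (el_mult _ _ _ Em Em) _))) _)) (el_const _ (/ 2))).
  - intros x y [Hxy _]. nra.
  - intros x y [Hxy _]. apply (unstretch_radicand_pos _ Hxy).
Qed.

Lemma stretch_maps : maps_to (shell q) (shell 0) (radial (stretch q)).
Proof.
  intros z [H1 H2]. pose proof (stretch_pos _ H1) as Hp.
  unfold shell. rewrite Cmod_radial by lra. split.
  - apply Rmult_lt_0_compat; lra.
  - apply stretch_bound; lra.
Qed.

Lemma unstretch_maps : maps_to (shell 0) (shell q) (radial (unstretch q)).
Proof.
  intros z Hz. pose proof (unstretch_pos _ (proj1 Hz)) as Hp.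
  unfold shell. rewrite Cmod_radial by lra. apply unstretch_bounds, Hz.
Qed.

Lemma stretch_diffeomorphism :
  diffeomorphism (shell q) (shell 0) (radial (stretch q)).
Proof.
  split; [apply stretch_maps |]. split.
  { intros n. apply radial_smooth; [lra | apply stretch_elementary]. }
  exists (radial (unstretch q)).
  split; [apply unstretch_maps |]. split.
  { intros n. apply radial_smooth; [lra | apply unstretch_elementary]. }
  split.
  - intros z [Hz _]. apply radial_radial.
    + apply Rlt_le, stretch_pos, Hz.
    + apply unstretch_stretch, Hz.
  - intros z [Hz _]. apply radial_radial.
    + apply Rlt_le, unstretch_pos, Hz.
    + apply stretch_unstretch, Hz.
Qed.

(** The term [- q^2 / r] of [h] contributes nothing to [h' + h / r], so [d_z]
    of the map is the constant [1 / (1 - q^2)]. *)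
Lemma stretch_harmonic :
  harmonic_map (shell q) (shell 0) euclidean (radial (stretch q)).
Proof.
  split; [apply stretch_maps |]. split.
  { apply stretch_diffeomorphism. }
  intros [x y] Hz. rewrite euclidean_harmonic_term.
  pose proof one_minus_q2_pos.
  assert (Hdz : forall s t, shell q (s, t) ->
            d_z (radial (stretch q)) (s, t) = RtoC (/ (1 - q ^ 2))).
  { intros s t [Hst _].
    set (r := Cmod (s, t)) in *.
    rewrite (d_z_radial _ (stretch q) s t (2 * q ^ 2 / (r ^ 3 * (1 - q ^ 2)))).
    - fold r. f_equal. unfold stretch. field. lra.
    - fold r. lra.
    - now apply locally_2d_forall.
    - fold r. unfold stretch. auto_derive; [nra |]. field. lra. }
  rewrite (d_zbar_of_modulus _ (fun _ => / (1 - q ^ 2)) x y 0).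
  - unfold RtoC. destruct Hz. f_equal; field; lra.
  - destruct Hz. lra.
  - apply locally_2d_impl with (2 := shell_open q (Rlt_le _ _ (proj1 Hq)) x y Hz).
    apply locally_2d_forall. exact Hdz.
  - apply @is_derive_const.
Qed.

Lemma stretch_rot_symmetric : rot_symmetric (shell q) (radial (stretch q)).
Proof.
  exists (fun r => r * stretch q r). intros r theta Hr [Hz _].
  rewrite Cmod_polar in Hz by lra. split.
  - apply Rmult_lt_0_compat, stretch_pos; trivial.
  - apply radial_polar. lra.
Qed.

End Stretch.

(** * Specialisation to the punctured disk and the annulus *)

Lemma rot_symmetric_harmonic_diffeo_ext U U' V V' sigma u :
  (forall z, U z <-> U' z) -> (forall z, V z <-> V' z) ->
  rot_symmetric_harmonic_diffeo U V sigma u ->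
  rot_symmetric_harmonic_diffeo U' V' sigma u.
Proof.
  intros HU HV ((h & Hh) & (Hm & HC & Hh2) & (_ & Hs & v & Hvm & Hvs & Hvu & Huv)).
  assert (Hm' : maps_to U' V' u) by (intros z Hz; apply HV, Hm, HU, Hz).
  split; [| split; [split; [| split] | split; [| split]]]; trivial.
  - exists h. intros r theta Hr Hz. apply Hh, HU, Hz. trivial.
  - intros z Hz. apply HC, HU, Hz.
  - intros z Hz. apply Hh2, HU, Hz.
  - intros n z Hz. apply Hs, HU, Hz.
  - exists v. repeat split.
    + intros z Hz. apply HU, Hvm, HV, Hz.
    + apply Hvs, HV; trivial.
    + apply Hvs, HV; trivial.
    + intros z Hz. apply Hvu, HU, Hz.
    + intros z Hz. apply Huv, HV, Hz.
Qed.

Theorem theorem1p3 :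
  forall a : R, 0 < a ->
    ~ (exists u : C -> C,
         rot_symmetric_harmonic_diffeo punctured_disk (annulus a) euclidean u) /\
    (exists u : C -> C,
       rot_symmetric_harmonic_diffeo (annulus a) punctured_disk euclidean u).
Proof.
  intros a Ha. split.
  - intros [u Hu].
    apply rot_symmetric_harmonic_diffeo_ext
      with (1 := punctured_disk_shell) (2 := annulus_shell a) in Hu.
    destruct Hu as (Hrot & Hharm & _).
    exact (no_rot_symmetric_harmonic_map_into_annulus
             (exp (- a)) u (exp_pos _) Hrot Hharm).
  - assert (Hq : 0 < exp (- a) < 1).
    { split; [apply exp_pos |]. rewrite <- exp_0. apply exp_increasing. lra. }
    exists (radial (stretch (exp (- a)))).
    apply rot_symmetric_harmonic_diffeo_ext
      with (U := shell (exp (- a))) (V := shell 0).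
    + intros z. symmetry. apply annulus_shell.
    + intros z. symmetry. apply punctured_disk_shell.
    + split; [| split].
      * apply stretch_rot_symmetric, Hq.
      * apply stretch_harmonic, Hq.
      * apply stretch_diffeomorphism, Hq.
Qed.
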